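(* Let $n\geq 3$ be an odd integer, let $t>1$ be a proper divisor of $n$, and let $0\leq s\leq t-1$. Let $G=D_{2n}=\langle a,b : a^n=b^2=e,\ b^{-1}ab=a^{-1}\rangle$ and let $H=\langle a^t,a^sb\rangle$. Let $(\alpha,\beta)\neq(0,0)$ be a pair of non-negative integers. Then $H$ is an $(\alpha,\beta)$-regular set of $G$ if and only if $(\alpha,\beta)=(|H|/2,|H|/2)$.
   Context: $D_{2n}$ is the dihedral group of order $2n$. An element $x$ of a group $G$ is a square if $x=y^2$ for some $y\in G$. A subset of $G$ is square-free if none of its elements is a square of $G$; a subset $S$ is normal if $g^{-1}Sg=S$ for all $g\in G$. For a normal square-free subset $S$ of $G$ (possibly empty), the Cayley sum graph $\mathrm{CayS}(G,S)$ is the simple graph with vertex set $G$ in which $x,y$ are adjacent if and only if $xy\in S$. A set $C$ of vertices of a graph is an $(\alpha,\beta)$-regular set in the graph if every vertex in $C$ is adjacent to exactly $\alpha$ vertices of $C$ and every vertex not in $C$ is adjacent to exactly $\beta$ vertices of $C$. A subset $C\subseteq G$ is an $(\alpha,\beta)$-regular set of $G$ if it is an $(\alpha,\beta)$-regular set in $\mathrm{CayS}(G,S)$ for some normal square-free subset $S$ of $G$. *)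

(* Defs.v *)
From mathcomp Require Import all_boot all_fingroup all_solvable.

Set Implicit Arguments.
Unset Strict Implicit.
Unset Printing Implicit Defensive.

Local Open Scope group_scope.

Definition regular_set (T : finType) (e : rel T) (alpha beta : nat)
    (C : {set T}) : Prop :=
  (forall x, x \in C -> #|[set y in C | e x y]| = alpha) /\
  (forall x, x \notin C -> #|[set y in C | e x y]| = beta).

Section CayleySum.

Variable gT : finGroupType.
Implicit Types (S C : {set gT}) (x y g : gT).

Definition is_square x : Prop := exists y, x = y ^+ 2.

Definition square_free S : Prop := forall x, x \in S -> ~ is_square x.

Definition normal_subset S : Prop := forall g, S :^ g = S.

(* The adjacency relation on the whole of gT.  It is that of a simple graph
   only for normal square-free S, see CayS_sym and CayS_irr. *)
Definition CayS S : rel gT := [rel x y | x * y \in S].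

Lemma CayS_sym S : normal_subset S -> symmetric (CayS S).
Proof.
move=> nS x y.
have SJ u g : (u ^ g \in S) = (u \in S) by rewrite -{1}(nS g) memJ_conjg.
by rewrite /CayS /= -(SJ (x * y) x) conjgE !mulgA mulVg mul1g.
Qed.

Lemma CayS_irr S : square_free S -> irreflexive (CayS S).
Proof. by move=> sfS x /=; apply/negP => /sfS; case; exists x. Qed.

Definition group_regular_set (alpha beta : nat) C : Prop :=
  exists S, [/\ normal_subset S, square_free S
              & regular_set (CayS S) alpha beta C].

End CayleySum.

(* As #|'D_(2 * n)| = 2 * n for n > 1, a generating pair satisfying the
   relations is exactly a pair for which they are defining relations. *)
Definition dihedral_generators (n : nat) (a b : 'D_(2 * n)) : Prop :=
  [/\ <<[set a; b]>> = [set: 'D_(2 * n)], a ^+ n = 1, b ^+ 2 = 1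
    & a ^ b = a^-1].

(* Main.v *)
(** Since n is odd, every rotation is a square, no reflection is one, and the
    reflections form a single conjugacy class.  Hence the normal square-free
    subsets of G are the empty set, which gives (0, 0), and the set of all
    reflections.  In the latter case x is adjacent exactly to the elements of
    the other coset of the rotations, and H has |H|/2 elements in each. *)

Require Import Defs.
From mathcomp Require Import all_boot all_fingroup all_solvable.

Set Implicit Arguments.
Unset Strict Implicit.
Unset Printing Implicit Defensive.

Section GeneralizedDihedral.

Local Open Scope group_scope.

(* [R] plays the role of the subgroup of rotations, and [b] of a reflection. *)
Variables (gT : finGroupType) (R : {group gT}) (b : gT).
Hypotheses (cRR : abelian R) (oddR : odd #|R|).
Hypothesis b2 : b ^+ 2 = 1.
Hypothesis Rb : forall c, c \in R -> c ^ b = c^-1.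
Hypothesis RbT : forall x, x \notin R -> x * b \in R.

(** As [#|R| + 1] is even and [c ^+ (#|R| + 1) = c], half that exponent gives a square root. *)
Lemma sqrt_in_odd_group c : c \in R -> exists2 d, d \in R & c = d ^+ 2.
Proof.
move=> Rc; exists (c ^+ #|R|.+1./2); first exact: groupX.
by rewrite -expgM muln2 even_halfK ?oddS ?oddR // expgS expg_cardG ?mulg1.
Qed.

Lemma reflection_decomp x : x \notin R -> exists2 r, r \in R & x = r * b.
Proof.
by move=> /RbT Rxb; exists (x * b) => //; rewrite -mulgA -expg2 b2 mulg1.
Qed.

Lemma reflection_comm c : c \in R -> b * c = c^-1 * b.
Proof. by move=> Rc; rewrite [RHS]conjgC Rb ?groupV // invgK. Qed.

(** Membership in [R] is a parity: for two reflections, [(r * b) * (q * b) = r * q^-1] lies in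
    [R]. *)
Lemma mul_in_rotations x y : (x * y \in R) = ((x \in R) == (y \in R)).
Proof.
have [Rx | NRx] := boolP (x \in R); first by rewrite groupMl //; case: (y \in R).
have [Ry | NRy] := boolP (y \in R); first by rewrite groupMr // (negPf NRx).
have [r Rr ->] := reflection_decomp NRx; have [q Rq ->] := reflection_decomp NRy.
rewrite mulgA -(mulgA r) reflection_comm // mulgA -mulgA -expg2 b2 mulg1.
by rewrite groupM ?groupV.
Qed.

Lemma reflections_normal : normal_subset (~: R).
Proof.
move=> g; apply/setP=> x; rewrite mem_conjg !inE conjgE invgK.
by rewrite !mul_in_rotations groupV; case: (g \in R); case: (x \in R).
Qed.

Lemma reflections_square_free : square_free (~: R).
Proof.
move=> x; rewrite inE => NRx [y xy].
by rewrite xy expg2 mul_in_rotations eqxx in NRx.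
Qed.

Lemma reflections_conjugate x y :
  x \notin R -> y \notin R -> exists g, y = x ^ g.
Proof.
move=> /reflection_decomp[r Rr ->] /reflection_decomp[q Rq ->].
(* For [d] in [R], conjugation by [d] sends [r * b] to [d ^- 2 * r * b]; this equals [q * b] exactly
   when [d ^+ 2 = q^-1 * r]. *)
have [d Rd Dd] : exists2 d, d \in R & q^-1 * r = d ^+ 2.
  by apply: sqrt_in_odd_group; rewrite groupM ?groupV.
exists d; rewrite conjgE -mulgA reflection_comm // !mulgA; congr (_ * b).
have cd z : z \in R -> commute d^-1 z.
  by move=> Rz; apply: (centsP cRR); rewrite ?groupV.
by rewrite cd // -mulgA -invMg -expg2 -Dd invMg invgK mulKVg.
Qed.

Lemma normal_square_free S :
  normal_subset S -> square_free S -> S = set0 \/ S = ~: R.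
Proof.
move=> nS sfS; have [->|[x Sx]] := set_0Vmem S; [by left | right].
have subS z : z \in S -> z \notin R.
  by move=> Sz; apply/negP=> /sqrt_in_odd_group[d _ Dz]; case: (sfS z Sz); exists d.
apply/setP=> y; rewrite inE; apply/idP/idP=> [/subS // | NRy].
have [g ->] := reflections_conjugate (subS x Sx) NRy.
by rewrite -(nS g) memJ_conjg.
Qed.

Lemma regular_set_empty (H : {group gT}) alpha beta :
  H \proper [set: gT] -> regular_set (CayS set0) alpha beta H ->
  (alpha, beta) = (0, 0).
Proof.
move=> /properP[_ [x _ NHx]] [regH regNH].
have nbr0 z : #|[set y in H | CayS set0 z y]| = 0%N.
  by apply: eq_card0 => y; rewrite !inE [CayS _ _ _]in_set0 andbF.
by rewrite -(regH 1) // -(regNH x) // !nbr0.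
Qed.

Lemma regular_set_reflections (H : {group gT}) :
  ~~ (H \subset R) -> regular_set (CayS (~: R)) (#|H| %/ 2) (#|H| %/ 2) H.
Proof.
case/subsetPn=> h Hh NRh.
(* Right translation by the reflection [h] of [H] exchanges the rotations and the reflections of
   [H]. *)
have cardHD : #|H :\: R| = #|H :&: R|.
  rewrite -(card_rcoset _ h); apply: eq_card => x.
  rewrite mem_rcoset !inE (@groupMr _ H) ?groupV // mul_in_rotations groupV.
  by rewrite (negPf NRh) andbC; case: (x \in R).
have cardHI : (#|H| %/ 2 = #|H :&: R|)%N.
  by rewrite -(cardsID R H) cardHD addnn -muln2 mulnK.
suff nbr x : #|[set y in H | CayS (~: R) x y]| = (#|H| %/ 2)%N by split=> x _.
rewrite cardHI; have [Rx | NRx] := boolP (x \in R).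
  rewrite -cardHD; apply: eq_card => y.
  by rewrite !inE [CayS _ _ _]in_setC mul_in_rotations Rx andbC; case: (y \in R).
apply: eq_card => y.
by rewrite !inE [CayS _ _ _]in_setC mul_in_rotations (negPf NRx); case: (y \in R).
Qed.

Lemma group_regular_setP (H : {group gT}) alpha beta :
    H \proper [set: gT] -> ~~ (H \subset R) -> (alpha, beta) <> (0, 0) ->
  group_regular_set alpha beta H <-> (alpha, beta) = (#|H| %/ 2, #|H| %/ 2)%N.
Proof.
move=> propH NsHR ab_neq0; have [regH regNH] := regular_set_reflections NsHR.
split=> [[S [nS sfS regS]] | [-> ->]]; last first.
  exists (~: R); split=> //; first exact: reflections_normal.
  exact: reflections_square_free.
have [S0 | SR] := normal_square_free nS sfS; subst S.
  by case: ab_neq0; apply: regular_set_empty propH regS.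
(* One vertex inside [H] and one outside determine both valencies; the outer one exists because [H]
   is proper. *)
have [_ [x _ NHx]] := properP propH.
case: regS => regS regNS.
by rewrite -(regS 1) // -(regNS x) // regH // regNH.
Qed.

End GeneralizedDihedral.

Section Dihedral.

Local Open Scope group_scope.

Lemma inverting_join (gT : finGroupType) (a b : gT) :
  a ^ b = a^-1 -> <<[set a; b]>> = <[a]> * <[b]>.
Proof.
move=> ab; have -> : <<[set a; b]>> = <[a]> <*> <[b]>.
  by rewrite joing_idl joing_idr.
by rewrite norm_joinEr // cycle_subG; apply/normP; rewrite -cycleJ ab cycleV.
Qed.

(** Serves twice: for the whole group it bounds the order of [a] from below, and for [H] it yields
    properness. *)
Lemma inverting_join_card (gT : finGroupType) (a b : gT) :
  b ^+ 2 = 1 -> a ^ b = a^-1 -> (#|<<[set a; b]>>| <= #[a] * 2)%N.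
Proof.
move=> b2 ab; rewrite inverting_join //.
have b_le2 : (#[b] <= 2)%N by rewrite dvdn_leq // order_dvdn b2.
apply: leq_trans (leq_mul (leqnn #[a]) b_le2); rewrite !orderE mul_cardG.
by rewrite leq_pmulr // cardG_gt0.
Qed.

End Dihedral.

Theorem theorem3p5 (n t s : nat) (a b : 'D_(2 * n)) (alpha beta : nat)
    (n_ge3 : 3 <= n) (n_odd : odd n)
    (t_gt1 : 1 < t) (t_dvd : t %| n) (t_proper : t < n)
    (s_le : 0 <= s <= t - 1)
    (ab_gen : dihedral_generators a b)
    (ab_neq0 : (alpha, beta) <> (0, 0)) :
  let H := <<[set (a ^+ t)%g; (a ^+ s * b)%g]>>%g in
  group_regular_set alpha beta H <->
  (alpha, beta) = (#|H| %/ 2, #|H| %/ 2).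
Proof.
move=> H; case: ab_gen => genT an b2 ab.
have cardT : #|[set: 'D_(2 * n)]%g| = 2 * n.
  by rewrite mul2n card_dihedral // ltnW.
have n_gt0 : 0 < n by apply: leq_trans n_ge3.
have leT := inverting_join_card b2 ab.
(* [a ^+ n = 1] gives [#[a] <= n], and [2 * n <= #[a] * 2] gives the converse. *)
have oa : #[a]%g = n.
  apply/eqP; rewrite eqn_leq dvdn_leq ?order_dvdn ?an //= -(leq_pmul2r (m := 2)) // [n * 2]mulnC.
  by apply: leq_trans leT; rewrite genT cardT.
have b_conj c : c \in <[a]>%g -> (c ^ b)%g = c^-1%g.
  by case/cycleP=> i ->; rewrite conjXg ab expVgn.
have defT : [set: 'D_(2 * n)]%g = (<[a]> * <[b]>)%g.
  by rewrite -genT inverting_join.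
(* Otherwise [<[a]>], of order [n], would be the whole group. *)
have bNa : b \notin <[a]>%g.
  apply/negP=> a_b; have := cardT; rewrite defT mulGSid ?cycle_subG // -orderE oa.
  by apply/eqP; rewrite ltn_eqF // ltn_Pmull.
have mulb x : x \notin <[a]>%g -> (x * b)%g \in <[a]>%g.
  have: x \in [set: 'D_(2 * n)]%g by rewrite inE.
  rewrite defT => /mulsgP[r _ Rr /cycleP[i ->] ->].
  (* Only the parity of the exponent of [b] matters; an even one would put [x] in [<[a]>]. *)
  rewrite -(odd_double_half i) expgD -mul2n expgM b2 expg1n mulg1.
  case: (odd i) => [_|]; last by rewrite mulg1 Rr.
  by rewrite expg1 -mulgA -expg2 b2 mulg1.
(* The generators of [H] satisfy dihedral relations too, so the order bound applies to them. *)
have sb_conj : ((a ^+ t) ^ (a ^+ s * b) = (a ^+ t)^-1)%g.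
  rewrite conjgM (_ : (a ^+ t) ^ (a ^+ s) = a ^+ t)%g ?b_conj ?mem_cycle //.
  by apply/conjg_fixP/commgP/commuteX2.
have sb2 : ((a ^+ s * b) ^+ 2 = 1)%g.
  rewrite expg2 mulgA -(mulgA _ b) (reflection_comm b_conj) ?mem_cycle //.
  by rewrite mulgA mulgV mul1g -expg2.
have leH := inverting_join_card sb2 sb_conj.
have leat : #[a ^+ t]%g <= n %/ t by rewrite orderXdiv oa.
apply: (@group_regular_setP _ <[a]>%G b _ _ b2 b_conj mulb <<_>>%G) => //.
- exact: cycle_abelian.
- by rewrite -orderE oa.
(* [#|H| <= 2 * (n %/ t) < 2 * n], the last step because [t > 1]. *)
- rewrite properT; apply: contraTneq leH => /= ->; rewrite cardT -ltnNge mulnC.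
  by rewrite ltn_pmul2l // (leq_ltn_trans leat) // ltn_Pdiv.
- apply/subsetPn; exists (a ^+ s * b)%g; first by rewrite mem_gen // !inE eqxx orbT.
  by rewrite groupMl ?mem_cycle.
Qed.
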